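(* Let $V_1=(1,b_1,c_1)$ and $V_2=(0,b_2,c_2)$ in $\mathfrak{se}(2)$ with $b_2^2+c_2^2=1$. Consider the map $\mathcal{IK}:\mathrm{SE}(2)\to\mathbb{R}^3$, $$\mathcal{IK}(\theta,x,y)=\big(\operatorname{arctan2}(\alpha,\beta),\ \rho,\ \theta-\operatorname{arctan2}(\alpha,\beta)\big),$$ where $\rho=\sqrt{\alpha^2+\beta^2}$ and $$\begin{bmatrix}\alpha\\ \beta\end{bmatrix}=\begin{bmatrix}b_2&c_2\\ -c_2&b_2\end{bmatrix}\left(\begin{bmatrix}x\\ y\end{bmatrix}-\begin{bmatrix}-c_1&b_1\\ b_1&c_1\end{bmatrix}\begin{bmatrix}1-\cos\theta\\ \sin\theta\end{bmatrix}\right).$$ Then $\mathcal{IK}$ is a global right inverse of the map $\mathcal{FK}^{(1,2,1)}:\mathbb{R}^3\to\mathrm{SE}(2)$, $\mathcal{FK}^{(1,2,1)}(t_1,t_2,t_3)=\exp(t_1V_1)\exp(t_2V_2)\exp(t_3V_1)$; that is, $\mathcal{FK}^{(1,2,1)}\circ\mathcal{IK}=\mathrm{id}_{\mathrm{SE}(2)}$.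
   Context: Elements of $\mathfrak{se}(2)$ are written $(a,b,c)=a e_\theta+b e_x+c e_y$, where $$e_\theta=\begin{bmatrix}0&-1&0\\ 1&0&0\\ 0&0&0\end{bmatrix},\quad e_x=\begin{bmatrix}0&0&1\\ 0&0&0\\ 0&0&0\end{bmatrix},\quad e_y=\begin{bmatrix}0&0&0\\ 0&0&1\\ 0&0&0\end{bmatrix}.$$ Elements of $\mathrm{SE}(2)$ are written $$(\theta,x,y)\equiv\begin{bmatrix}\cos\theta&-\sin\theta&x\\ \sin\theta&\cos\theta&y\\ 0&0&1\end{bmatrix}.$$ The angle $\theta$ is determined by the group element only modulo $2\pi$; in the formula for $\mathcal{IK}$, $\theta$ is a fixed choice of real representative (for instance in $(-\pi,\pi]$). $\exp$ is the matrix exponential and products are matrix products. $\operatorname{arctan2}(x,y)$ denotes the arctangent of $y/x$ taking into account the quadrant of the point $(x,y)$ (i.e. the polar angle of $(x,y)$, in $(-\pi,\pi]$), with the convention $\operatorname{arctan2}(0,0)=0$; note the order of arguments. *)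

(* Defs.v *)
From mathcomp Require Import all_boot all_order all_algebra.
From mathcomp Require Import all_classical all_reals all_analysis.
Set Implicit Arguments.
Unset Strict Implicit.
Unset Printing Implicit Defensive.
Import Order.TTheory GRing.Theory Num.Theory.
Import numFieldNormedType.Exports.
Local Open Scope classical_set_scope.
Local Open Scope ring_scope.

Section Defs.
Variable R : realType.

(* Matrix with the given list of rows; missing entries are 0. *)
Definition mx_of_rows (m n : nat) (rows : seq (seq R)) : 'M[R]_(m, n) :=
  \matrix_(i, j) nth 0 (nth [::] rows i) j.

Definition e_theta : 'M[R]_3 :=
  mx_of_rows 3 3 [:: [:: 0; -1; 0];
                     [:: 1;  0; 0];
                     [:: 0;  0; 0]].

Definition e_x : 'M[R]_3 :=
  mx_of_rows 3 3 [:: [:: 0; 0; 1];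
                     [:: 0; 0; 0];
                     [:: 0; 0; 0]].

Definition e_y : 'M[R]_3 :=
  mx_of_rows 3 3 [:: [:: 0; 0; 0];
                     [:: 0; 0; 1];
                     [:: 0; 0; 0]].

Definition se2 (a b c : R) : 'M[R]_3 := a *: e_theta + b *: e_x + c *: e_y.

Definition SE2_mx (theta x y : R) : 'M[R]_3 :=
  mx_of_rows 3 3 [:: [:: cos theta; - sin theta; x];
                     [:: sin theta;   cos theta; y];
                     [:: 0;           0;         1]].

Definition SE2 : set 'M[R]_3 :=
  [set g | exists theta x y : R, g = SE2_mx theta x y].

(* A choice, for each element of SE(2), of a real representative of its angle,
   which is determined only modulo 2 pi. Values outside SE(2) are irrelevant. *)
Definition angle_choice (angle : 'M[R]_3 -> R) : Prop :=
  forall theta x y : R,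
    exists k : int, angle (SE2_mx theta x y) = theta + k%:~R * (2 * pi).

(* The limit is taken for the max norm on matrices. *)
Definition expmx (n : nat) (A : 'M[R]_n.+1) : 'M[R]_n.+1 :=
  limn (series (fun k : nat => (k`!%:R)^-1 *: A ^+ k)).

(* Polar angle of (x, y), in ]-pi, pi]; the abscissa is the FIRST argument. *)
Definition arctan2 (x y : R) : R :=
  if 0 < x then atan (y / x)
  else if x < 0 then
    if 0 <= y then atan (y / x) + pi else atan (y / x) - pi
  else if 0 < y then pi / 2
  else if y < 0 then - (pi / 2)
  else 0.

Definition FK121 (V1 V2 : 'M[R]_3) (t : R * R * R) : 'M[R]_3 :=
  let: (t1, t2, t3) := t in
  expmx (t1 *: V1) *m expmx (t2 *: V2) *m expmx (t3 *: V1).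

Definition alpha_beta (b1 c1 b2 c2 theta x y : R) : 'cV[R]_2 :=
  mx_of_rows 2 2 [:: [:: b2; c2]; [:: - c2; b2]] *m
    (mx_of_rows 2 1 [:: [:: x]; [:: y]] -
     mx_of_rows 2 2 [:: [:: - c1; b1]; [:: b1; c1]] *m
       mx_of_rows 2 1 [:: [:: 1 - cos theta]; [:: sin theta]]).

(* On g = SE2_mx theta x y, the entries g 0 ord_max and g 1 ord_max are x and
   y. *)
Definition IK (angle : 'M[R]_3 -> R) (b1 c1 b2 c2 : R) (g : 'M[R]_3)
    : R * R * R :=
  let theta := angle g in
  let ab := alpha_beta b1 c1 b2 c2 theta (g 0 ord_max) (g 1 ord_max) in
  let alpha := ab 0 0 in
  let beta := ab 1 0 in
  let rho := Num.sqrt (alpha ^+ 2 + beta ^+ 2) in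
  (arctan2 alpha beta, rho, theta - arctan2 alpha beta).

End Defs.

(* Main.v *)
(* exp(s V1) and exp(s V2) have closed forms because V1^3 = - V1 and V2^2 = 0:
   a rotation of angle s about a point independent of s, and a translation.
   Hence exp(t1 V1) exp(t2 V2) exp(t3 V1) is exp((t1 + t3) V1) with its
   translation part shifted by t2 times (b2, c2) rotated by t1. For
   t1 + t3 = theta, the defect between (x, y) and the translation part of
   exp(theta V1) must therefore have, in the orthonormal frame (b2, c2),
   (- c2, b2), radius t2 and polar angle t1. *)
Require Import Defs.
From mathcomp Require Import all_boot all_order all_algebra.
From mathcomp Require Import all_classical all_reals all_analysis.
From mathcomp Require Import ring.
Import Order.TTheory GRing.Theory Num.Theory.
Import numFieldNormedType.Exports.
Local Open Scope classical_set_scope.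
Local Open Scope ring_scope.

Lemma expmx_unique (R : realType) (n : nat) (A L : 'M[R]_n.+1) :
  series (fun k : nat => (k`!%:R)^-1 *: A ^+ k) @ \oo --> L -> expmx A = L.
Proof. by move=> /cvg_lim; apply; exact: norm_hausdorff. Qed.

Lemma cvg_series_single (R : realType) (V : normedModType R) (v : V) :
  series (fun k : nat => (k == 0%N)%:R *: v) @ \oo --> v.
Proof.
apply: cvg_near_cst; near=> m.
have -> : m = m.-1.+1 by rewrite prednK//; near: m; exact: nbhs_infty_gt.
by rewrite /series /= big_nat_recl //= scale1r big1 ?addr0// => i _; rewrite scale0r.
Unshelve. all: by end_near. Qed.

Lemma cvg_series_scalev (R : realType) (V : normedModType R) (f : R ^nat) (l : R)
    (v : V) :
  series f @ \oo --> l -> series (fun k => f k *: v) @ \oo --> l *: v.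
Proof.
move=> fl; rewrite (_ : series _ = fun n => series f n *: v).
  exact: cvgZr_tmp.
by apply/funext => n; rewrite /series /= scaler_suml.
Qed.

Lemma cvg_series_sin_coeff (R : realType) (t : R) :
  series (sin_coeff t) @ \oo --> sin t.
Proof. by rewrite unlock; exact: is_cvg_series_sin_coeff. Qed.

Lemma cvg_series_cos_coeff (R : realType) (t : R) :
  series (cos_coeff t) @ \oo --> cos t.
Proof. by rewrite unlock; exact: is_cvg_series_cos_coeff. Qed.

(** Two more factors of [A] change the sign of any positive power. The exponents start at 1 because
    [A ^+ 0 = 1] escapes this rule. *)
Lemma exprS_cubeN (K : pzRingType) (E : lalgType K) (A : E) (m : nat) :
  A ^+ 3 = - A ->
  A ^+ m.*2.+1 = (-1) ^+ m *: A /\ A ^+ m.*2.+2 = (-1) ^+ m *: A ^+ 2.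
Proof.
move=> A3; have odd_case k : A ^+ k.*2.+1 = (-1) ^+ k *: A.
  elim: k => [|k IH]; first by rewrite scale1r.
  rewrite doubleS -[k.*2.+3]addn2 exprD IH -scalerAl -exprS A3 exprSr mulrN1.
  by rewrite scaleNr scalerN.
by split=> //; rewrite exprSr odd_case -scalerAl -expr2.
Qed.

(** Rodrigues' formula: odd powers of [A] sum to the sine series, positive even ones to the cosine
    series times [- A ^+ 2]. At index 0 the cosine series gives [- A ^+ 2] where the exponential has
    [1], whence the correction [1 + A ^+ 2]. *)
Lemma expmx_cubeN (R : realType) (n : nat) (A : 'M[R]_n.+1) (t : R) :
  A ^+ 3 = - A ->
  expmx (t *: A) = sin t *: A - cos t *: A ^+ 2 + (1 + A ^+ 2).
Proof.
move=> A3; apply: expmx_unique.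
have -> : (fun k : nat => (k`!%:R)^-1 *: (t *: A) ^+ k) =
  (fun k => sin_coeff t k *: A) \+ (fun k => cos_coeff t k *: - A ^+ 2)
  \+ (fun k => (k == 0%N)%:R *: (1 + A ^+ 2)).
  apply/funext => k; rewrite /= exprZn scalerA /sin_coeff /cos_coeff /=.
  case: k => [|k].
    rewrite !(mul0r, mul1r, scale0r, add0r) /= !expr0 fact0 invr1.
    by rewrite mul1r !scale1r addrCA addNr addr0.
  rewrite scale0r addr0 scalerN.
  have [podd peven] := exprS_cubeN _ _ _ k./2 A3.
  (* The exponent now has one of the two shapes of [exprS_cubeN], according to the parity of [k]. *)
  have -> : A ^+ k.+1 = A ^+ (odd k + k./2.*2).+1 by rewrite odd_double_half.
  rewrite /= negbK uphalf_half -exprnP.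
  case: (odd k); rewrite /= ?add0n ?add1n ?podd ?peven scalerA.
    rewrite !mul0r scale0r add0r -scaleNr; congr (_ *: _).
    by rewrite [(-1) ^+ _.+1]exprS; ring.
  by rewrite !mul0r scale0r subr0; congr (_ *: _); ring.
have seriesD (f g : nat -> 'M[R]_n.+1) : series (f \+ g) = series f \+ series g.
  by apply/funext => m; rewrite /series /= big_split.
rewrite -scalerN !seriesD; apply: cvgD; last exact: cvg_series_single.
apply: cvgD; apply: cvg_series_scalev.
  exact: cvg_series_sin_coeff.
exact: cvg_series_cos_coeff.
Qed.

Lemma expmx_sqr0 (R : realType) (n : nat) (A : 'M[R]_n.+1) :
  A ^+ 2 = 0 -> expmx A = 1 + A.
Proof.
move=> A2; apply: expmx_unique; apply: cvg_near_cst; near=> m.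
have [p ->] : exists p, m = p.+2.
  by exists m.-2; rewrite -subn2 -addn2 subnK//; near: m; exact: nbhs_infty_gt.
rewrite /series /= !big_nat_recl //= !expr0 expr1 fact0 factS fact0 muln1 invr1.
rewrite !scale1r big1 ?addr0// => i _; rewrite -[i.+2]addn2 exprD A2 mulr0 scaler0//.
Unshelve. all: by end_near. Qed.

(** An instance of Cayley-Hamilton: the characteristic polynomial is X^3 + X for all [b] and [c]. *)
Lemma se2_cube (R : realType) (b c : R) : se2 1 b c ^+ 3 = - se2 1 b c.
Proof.
rewrite exprS expr2 -!mulmxE; apply/matrixP => i j.
rewrite !mxE !big_ord_recl big_ord0 !mxE !big_ord_recl !big_ord0 !mxE.
case: i j => [[|[|[|//]]] ?] [[|[|[|//]]] ?]; rewrite /=; ring.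
Qed.

(** The fixed point of this rotation is [(- c, b)]. *)
Lemma expmx_se2_rot (R : realType) (b c t : R) :
  expmx (t *: se2 1 b c) =
  SE2_mx t (b * sin t - c * (1 - cos t)) (b * (1 - cos t) + c * sin t).
Proof.
rewrite expmx_cubeN ?se2_cube//; apply/matrixP => i j.
rewrite expr2 -mulmxE !mxE !big_ord_recl big_ord0 !mxE.
case: i j => [[|[|[|//]]] ?] [[|[|[|//]]] ?]; rewrite /=; ring.
Qed.

Lemma se2_sqr0 (R : realType) (b c t : R) : (t *: se2 0 b c) ^+ 2 = 0.
Proof.
rewrite expr2 -mulmxE; apply/matrixP => i j.
rewrite !mxE !big_ord_recl big_ord0 !mxE.
case: i j => [[|[|[|//]]] ?] [[|[|[|//]]] ?]; rewrite /=; ring.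
Qed.

Lemma expmx_se2_trans (R : realType) (b c t : R) :
  expmx (t *: se2 0 b c) = SE2_mx 0 (t * b) (t * c).
Proof.
rewrite expmx_sqr0 ?se2_sqr0//; apply/matrixP => i j.
rewrite !mxE sin0 cos0.
case: i j => [[|[|[|//]]] ?] [[|[|[|//]]] ?]; rewrite /=; ring.
Qed.

Lemma SE2_mxM (R : realType) (t x y t' x' y' : R) :
  SE2_mx t x y *m SE2_mx t' x' y' =
  SE2_mx (t + t') (cos t * x' - sin t * y' + x) (sin t * x' + cos t * y' + y).
Proof.
apply/matrixP => i j; rewrite !mxE !big_ord_recl big_ord0 !mxE sinD cosD.
case: i j => [[|[|[|//]]] ?] [[|[|[|//]]] ?]; rewrite /=; ring.
Qed.

Lemma FK121E (R : realType) (b1 c1 b2 c2 t1 t2 t3 : R) :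
  FK121 (se2 1 b1 c1) (se2 0 b2 c2) (t1, t2, t3) =
  SE2_mx (t1 + t3)
    (b1 * sin (t1 + t3) - c1 * (1 - cos (t1 + t3))
       + t2 * (cos t1 * b2 - sin t1 * c2))
    (b1 * (1 - cos (t1 + t3)) + c1 * sin (t1 + t3)
       + t2 * (sin t1 * b2 + cos t1 * c2)).
Proof.
rewrite /FK121 !expmx_se2_rot expmx_se2_trans !SE2_mxM addr0 sinD cosD.
congr SE2_mx; ring.
Qed.

(** Factoring out [x ^+ 2] leaves [1 + (y / x) ^+ 2], whose root cancels [cos (atan (y / x))]. The
    absolute value appears because cosine is positive on the range of [atan]. *)
Lemma sqrt_atan_div (R : realType) (x y : R) : x != 0 ->
  Num.sqrt (x ^+ 2 + y ^+ 2) * cos (atan (y / x)) = `|x| /\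
  Num.sqrt (x ^+ 2 + y ^+ 2) * sin (atan (y / x)) = `|x| * (y / x).
Proof.
move=> x0; have cosE : Num.sqrt (x ^+ 2 + y ^+ 2) * cos (atan (y / x)) = `|x|.
  have -> : x ^+ 2 + y ^+ 2 = x ^+ 2 * (1 + (y / x) ^+ 2) by field.
  rewrite cos_atan sqrtrM ?sqr_ge0// sqrtr_sqr mulfK// sqrtr_eq0 -ltNge.
  by rewrite ltr_pwDl// sqr_ge0.
split=> //; have tanE := atanK (y / x).
set a := atan (y / x) in cosE tanE *.
rewrite -tanE -cosE -mulrA /tan [cos a * _]mulrC divfK//.
by apply/lt0r_neq0/cos_gt0_pihalf; rewrite atan_gtNpi2 atan_ltpi2.
Qed.

Lemma arctan2_polar (R : realType) (x y : R) :
  Num.sqrt (x ^+ 2 + y ^+ 2) * cos (arctan2 x y) = x /\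
  Num.sqrt (x ^+ 2 + y ^+ 2) * sin (arctan2 x y) = y.
Proof.
rewrite /arctan2; case: (ltgtP x 0) => [x0|x0|->].
- have xN0 : x != 0 by rewrite lt_eqF.
  have [ec es] := sqrt_atan_div _ x y xN0.
  rewrite ltr0_norm// in ec es.
  (* For negative [x], [atan] yields the direction opposite to [(x, y)]; a half turn in either sense
     corrects it. *)
  have ey : y = x * (y / x) by field.
  have [y0|y0] := leP 0 y.
    by rewrite cosDpi sinDpi !mulrN ec es opprK mulNr opprK -ey.
  have cosBpi z : cos (z - pi) = - cos z :> R.
    by rewrite -[in RHS](subrK pi z) cosDpi opprK.
  have sinBpi z : sin (z - pi) = - sin z :> R.
    by rewrite -[in RHS](subrK pi z) sinDpi opprK.
  by rewrite cosBpi sinBpi !mulrN ec es opprK mulNr opprK -ey.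
- have xN0 : x != 0 by rewrite gt_eqF.
  have [-> ->] := sqrt_atan_div _ x y xN0.
  by rewrite gtr0_norm//; split=> //; field.
- rewrite expr0n add0r sqrtr_sqr.
  case: (ltgtP 0 y) => [y0|y0|<-].
  + by rewrite cos_pihalf sin_pihalf gtr0_norm// mulr0 mulr1.
  + by rewrite cosN sinN cos_pihalf sin_pihalf ltr0_norm// mulr0 mulrNN mulr1.
  + by rewrite normr0 !mul0r.
Qed.

Lemma periodic_int (R : realType) (f : R -> R) (T : R) :
  periodic f T -> forall (k : int) (a : R), f (a + k%:~R * T) = f a.
Proof.
move=> fT [n|n] a; first by rewrite mulr_natl periodicn.
rewrite NegzE mulrNz mulNr mulr_natl.
(* A negative shift is undone by the positive one, to which [periodicn] applies. *)
by rewrite -[in RHS](subrK (T *+ n.+1) a) periodicn.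
Qed.

Theorem mainTheorem2 (R : realType) (b1 c1 b2 c2 : R)
    (angle : 'M[R]_3 -> R) :
  b2 ^+ 2 + c2 ^+ 2 = 1 ->
  angle_choice angle ->
  let V1 := se2 1 b1 c1 in
  let V2 := se2 0 b2 c2 in
  (forall t : R * R * R, SE2 (FK121 V1 V2 t)) /\
  (forall g : 'M[R]_3, SE2 g -> FK121 V1 V2 (IK angle b1 c1 b2 c2 g) = g).
Proof.
move=> unit_bc angleP V1 V2; split=> [[[t1 t2] t3]|_ [theta [x [y ->]]]].
  by rewrite FK121E; do 3 eexists.
rewrite /IK; have [k ->] := angleP theta x y.
(* [phi] is the representative picked by [angle]; it may differ from [theta] by full turns. *)
set phi := theta + _.
have cos_phi : cos phi = cos theta.
  by rewrite /phi mulr_natl periodic_int//; exact: cosD2pi.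
have sin_phi : sin phi = sin theta.
  by rewrite /phi mulr_natl periodic_int//; exact: sinD2pi.
set ab := alpha_beta _ _ _ _ _ _ _.
(* [(X, Y)] is the defect between [(x, y)] and the translation part of [expmx (phi *: V1)]. *)
pose X := x - (b1 * sin phi - c1 * (1 - cos phi)).
pose Y := y - (b1 * (1 - cos phi) + c1 * sin phi).
have alphaE : ab 0 0 = b2 * X + c2 * Y.
  rewrite /ab /X /Y !mxE !big_ord_recl big_ord0 !mxE !big_ord_recl !big_ord0 !mxE /=.
  ring.
have betaE : ab 1 0 = - c2 * X + b2 * Y.
  rewrite /ab /X /Y !mxE !big_ord_recl big_ord0 !mxE !big_ord_recl !big_ord0 !mxE /=.
  ring.
rewrite FK121E subrKC.
have [polar_cos polar_sin] := arctan2_polar _ (ab 0 0) (ab 1 0).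
(* Distributing the radius over cosine and sine turns the products into the frame coordinates of the
   defect. *)
rewrite !mulrBr !mulrDr !mulrA polar_cos polar_sin alphaE betaE.
have -> : SE2_mx theta x y = SE2_mx phi x y by rewrite /SE2_mx cos_phi sin_phi.
congr SE2_mx.
(* Going to the frame and back multiplies the defect by [b2 ^+ 2 + c2 ^+ 2]; the excess over [x] is
   isolated so that [unit_bc] cancels it. *)
- transitivity (x + (b2 ^+ 2 + c2 ^+ 2 - 1) * X); first by rewrite /X; ring.
  by rewrite unit_bc subrr mul0r addr0.
- transitivity (y + (b2 ^+ 2 + c2 ^+ 2 - 1) * Y); first by rewrite /Y; ring.
  by rewrite unit_bc subrr mul0r addr0.
Qed.
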